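(* Let $k\ge 1$ and $\rho\in\mathcal{S}_k$. The sequence $\mathrm{r}_n(\rho)$ has polynomial growth (i.e. is bounded above by some polynomial in $n$) if and only if $\rho$ is trivially Wilf equivalent to $12\cdots k$ or to $12\cdots(k-2)\,k\,(k-1)$.
   Context: $\mathcal{S}_n$ is the set of permutations of $[n]$. For $\pi=\pi_1\cdots\pi_n$, the reversal is $\pi^r=\pi_n\cdots\pi_1$ and the complement is $\pi^c=(n+1-\pi_1)\cdots(n+1-\pi_n)$. A word $w$ contains $\rho\in\mathcal{S}_k$ if some subsequence $w_{i_1}\cdots w_{i_k}$ ($i_1<\cdots<i_k$) satisfies $w_{i_a}\le w_{i_b}$ iff $\rho_a\le\rho_b$; otherwise it avoids $\rho$. $\mathcal{R}_n=\{\pi\pi^r:\pi\in\mathcal{S}_n\}$ (concatenation of $\pi$ with its reversal), and $\mathrm{r}_n(\rho)$ is the number of members of $\mathcal{R}_n$ avoiding $\rho$. Two patterns $\rho,\tau\in\mathcal{S}_k$ are trivially Wilf equivalent if $\tau$ is obtained from $\rho$ by a composition of reversal and complement, i.e. $\tau\in\{\rho,\rho^r,\rho^c,\rho^{rc}\}$. *)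

(* Defs.v *)
From HB Require Import structures.
From mathcomp Require Import all_boot all_order all_fingroup all_algebra.

Set Implicit Arguments.
Unset Strict Implicit.
Unset Printing Implicit Defensive.

Import Order.TTheory GRing.Theory Num.Theory.

(* Positions and letters are numbered from 0: a permutation of [k] is an      *)
(* element of 'S_k, and a word of length m over [n] is an m.-tuple of 'I_n.   *)

Definition perm_word n (pi : 'S_n) : n.-tuple 'I_n := [tuple pi i | i < n].

Definition reversal n (pi : 'S_n) : 'S_n :=
  perm (inj_comp (@perm_inj _ pi) (@rev_ord_inj n)).

Definition complement n (pi : 'S_n) : 'S_n :=
  perm (inj_comp (@rev_ord_inj n) (@perm_inj _ pi)).

Definition contains m n k (w : m.-tuple 'I_n) (rho : 'S_k) : bool :=
  [exists i : {ffun 'I_k -> 'I_m},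
     [forall a : 'I_k, forall b : 'I_k, (a < b) ==> (i a < i b)]
  && [forall a : 'I_k, forall b : 'I_k,
        (tnth w (i a) <= tnth w (i b)) == (rho a <= rho b)]].

Definition avoids m n k (w : m.-tuple 'I_n) (rho : 'S_k) : bool :=
  ~~ contains w rho.

Definition rev_double n (pi : 'S_n) : (n + n).-tuple 'I_n :=
  [tuple of perm_word pi ++ perm_word (reversal pi)].

Definition rev_double_lists n : {set (n + n).-tuple 'I_n} :=
  [set rev_double pi | pi : 'S_n].

Definition r_count k (rho : 'S_k) (n : nat) : nat :=
  #|[set w in rev_double_lists n | avoids w rho]|.

Definition trivially_wilf_equiv k (rho tau : 'S_k) : bool :=
  tau \in [:: rho; reversal rho; complement rho; complement (reversal rho)].

(* The pattern 1 2 ... (k-2) k (k-1), which only makes sense for k >= 2; for  *)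
(* k < 2 the value is the identity, the only element of 'S_k.                 *)
Definition swap_last k : 'S_k :=
  match k with
  | k'.+2 => tperm (inord k') ord_max
  | _ => perm_one _
  end.

(* The coefficients range over an archimedean ordered field (such as the      *)
(* rationals or the reals): over a non-archimedean one, an infinitely large   *)
(* constant would bound every sequence of natural numbers.                    *)
Definition polynomial_growth (R : archiRealFieldType) (u : nat -> nat) : Prop :=
  exists p : {poly R}, forall n : nat, ((u n)%:R <= p.[n%:R])%R.

(* Main.v *)
Require Import Defs.
From HB Require Import structures.
From mathcomp Require Import all_boot all_order all_fingroup all_algebra.
From mathcomp Require Import zify.

(* Write w for the word of pi, so that the word to be searched is w w^r.

   Upper bounds. If n >= 2^k, then w w^r contains an increasing word of length
   k: keep the larger of the two sets of letters above and below the first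
   letter, and use the copy of that letter on the appropriate side. So r_n
   vanishes eventually for 12...k. For 12...(k-2)k(k-1), a word w avoiding it
   is a concatenation of boundedly many descending runs of consecutive values,
   by induction on k. Write w = a L b Q with b the first letter above a, the
   leading maxima having been stripped. The part above a avoids the pattern for
   k-1; the part of Q below a is short, since a and b play k-1 and k in front
   of it; and L is shorter than w but followed by one more increasing letter
   above it, which can happen fewer than k times.

   Lower bounds. There are exponentially many words in each of three classes:
   every letter is extremal among those from it onwards; every letter is
   extremal among those up to it; skew sums of words 1 and 12. So a pattern with
   polynomial growth occurs in w w^r for some w in each class. By the first
   class, an end of the pattern is its minimum or maximum, and up to symmetry
   the pattern starts with its minimum. By the third, it then ends with its
   maximum k, or with k(k-1). By the second, the letters before k increase. *)

Set Implicit Arguments.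
Unset Strict Implicit.
Unset Printing Implicit Defensive.

Import GRing.Theory Num.Theory.

(** * Avoiding a swapped increasing pattern forces few runs *)

Notation doubled w := (w ++ rev w).

Lemma sorted_ltn_rcons (t : seq nat) x :
  sorted ltn (rcons t x) = all (gtn x) t && sorted ltn t.
Proof.
rewrite -[LHS]/(sorted (fun a b => gtn b a) _) -[in LHS]rev_sorted rev_rcons /=.
rewrite path_sortedE; last by move=> ? ? ? /=; lia.
by rewrite all_rev rev_sorted.
Qed.

Lemma subseq_doubled (u w : seq nat) :
  subseq u w -> subseq (doubled u) (doubled w).
Proof. by move=> uw; apply: cat_subseq => //; rewrite subseq_rev. Qed.

Lemma sorted_in_doubled k (w : seq nat) : uniq w -> 2 ^ k <= size w ->
  exists t, [/\ size t = k, sorted ltn t & subseq t (doubled w)].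
Proof.
elim: k w => [|k IH] w Uw; first by exists [::]; rewrite sub0seq.
case: w Uw => [|x w] /=; first by rewrite leqn0 expn_eq0.
case/andP=> xw Uw szw.
have szE : size [seq y <- w | x < y] + size [seq y <- w | y < x] = size w.
  rewrite !size_filter -(count_predC (ltn x) w); congr addn.
  apply: eq_in_count => y yw /=; have : y != x by apply: contraNneq xw => <-.
  by lia.
have [le|lt] := leqP (2 ^ k) (size [seq y <- w | x < y]).
- have [t [szt st sub]] := IH _ (filter_uniq _ Uw) le.
  exists (x :: t); split; rewrite /= ?szt //.
    rewrite path_sortedE ?st ?andbT; last exact: ltn_trans.
    apply/allP => y /(mem_subseq sub).
    by rewrite mem_cat mem_rev orbb mem_filter => /andP[].
  rewrite eqxx rev_cons; apply: subseq_trans sub _.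
  apply: subseq_trans (subseq_doubled (filter_subseq _ w)) _.
  by rewrite cat_subseq // subseq_rcons.
(* The tail has at least [2 ^ k.+1 - 1] letters other than [x], so if fewer than [2 ^ k] lie above
   [x], then [2 ^ k] lie below; they precede the second copy of [x]. *)
- have le : 2 ^ k <= size [seq y <- w | y < x] by rewrite expnS in szw; lia.
  have [t [szt st sub]] := IH _ (filter_uniq _ Uw) le.
  exists (rcons t x); split; rewrite ?size_rcons ?szt //.
    rewrite sorted_ltn_rcons st andbT; apply/allP => y /(mem_subseq sub).
    by rewrite mem_cat mem_rev orbb mem_filter => /andP[].
  have dE : doubled (x :: w) = (x :: doubled w) ++ [:: x].
    by rewrite rev_cons -cats1 /= catA.
  rewrite -[X in is_true X]/(subseq (rcons t x) (doubled (x :: w))) dE -cats1.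
  apply: cat_subseq => //.
  apply: subseq_trans sub _.
  apply: subseq_trans (subseq_doubled (filter_subseq _ w)) _.
  exact: subseq_cons.
Qed.

(* Occurrence of [1 2 ... k (k+2) (k+1)]: here [k] is two less than the length
   of the pattern. *)
Definition has_swap k (w : seq nat) := exists s a b,
  [/\ size s = k, sorted ltn (s ++ [:: a; b]) &
      subseq (s ++ [:: b; a]) (doubled w)].

Lemma has_swap_subseq k u w : subseq u w -> has_swap k u -> has_swap k w.
Proof.
move=> uw [s [a [b [szs ss sub]]]]; exists s, a, b; split=> //.
exact: subseq_trans sub (subseq_doubled uw).
Qed.

Lemma has_swap_cons k x w :
  has_swap k [seq y <- w | x < y] -> has_swap k.+1 (x :: w).
Proof.
move=> [s [a [b [szs ss sub]]]]; exists (x :: s), a, b; split; rewrite /= ?szs //.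
  rewrite path_sortedE ?ss ?andbT; last exact: ltn_trans.
  apply/allP => y ys; have /(mem_subseq sub) : y \in s ++ [:: b; a].
    by move: ys; rewrite !mem_cat !inE [(y == a) || _]orbC.
  by rewrite mem_cat mem_rev orbb mem_filter => /andP[].
rewrite eqxx rev_cons; apply: subseq_trans sub _.
apply: subseq_trans (subseq_doubled (filter_subseq _ w)) _.
by rewrite cat_subseq // subseq_rcons.
Qed.

(** The reversed half ends in [b a], after both copies of [l], and [doubled l] supplies the
    increasing letters below them. *)
Lemma has_swap_below k a b l : a < b -> all (gtn a) l -> uniq l ->
  2 ^ k <= size l -> has_swap k (a :: b :: l).
Proof.
move=> ab al Ul szl; have [t [szt st sub]] := sorted_in_doubled Ul szl.
exists t, a, b; split=> //.
  have at_ : all (gtn a) t.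
    apply/allP => y /(mem_subseq sub).
    by rewrite mem_cat mem_rev orbb => /(allP al).
  rewrite -cat_rcons cats1 !sorted_ltn_rcons all_rcons st at_ /= ab /= andbT.
  by apply: sub_all at_ => y /=; lia.
have -> : doubled [:: a, b & l] = [:: a; b] ++ doubled l ++ [:: b; a].
  by rewrite !rev_cons -!cats1 -!catA.
by apply: subseq_trans (suffix_subseq _ _); rewrite cat_subseq.
Qed.

(** An increasing word [t a b] turns around at its top: [t a b b a] contains [t b a]. *)
Lemma has_swap_sorted k t w : sorted ltn t -> size t = k.+2 -> subseq t w ->
  has_swap k w.
Proof.
case/lastP: t => // t b; case/lastP: t => [|t a]; rewrite ?size_rcons // => st.
move=> [szt] sub; exists t, a, b; split=> //.
  by rewrite -cat_rcons cats1.
apply: subseq_trans (subseq_doubled sub).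
rewrite !rev_rcons -!cats1 -!catA; apply: cat_subseq => //.
by apply: subseq_trans (suffix_subseq [:: a; b] _); apply: prefix_subseq.
Qed.

(* [y] continues a run: it follows the letter next above it among those of [w]. *)
Definition good (w : seq nat) y := exists p x q,
  [/\ w = p ++ [:: x, y & q], y < x & forall z, z \in w -> ~~ (y < z < x)].

(** [S] covers the letters that start a run. It may contain others, so that lists can be merged and
    padded freely. *)
Definition few_runs C (w : seq nat) := exists S : seq nat,
  size S <= C /\ forall y, y \in w -> y \notin S -> good w y.

Lemma few_runs_le C C' w : C <= C' -> few_runs C w -> few_runs C' w.
Proof. by move=> le [S [szS HS]]; exists S; split=> //; apply: leq_trans le. Qed.

Lemma few_runs_size w : few_runs (size w) w.
Proof. by exists w; split=> // y ->. Qed.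

(** No letter of one word lies between two letters of the other, so the runs of each factor
    survive. *)
Lemma few_runs_cat C1 C2 w1 w2 :
  (forall x y, x \in w1 -> y \in w2 -> x < y) \/
  (forall x y, x \in w1 -> y \in w2 -> y < x) ->
  few_runs C1 w1 -> few_runs C2 w2 -> few_runs (C1 + C2) (w1 ++ w2).
Proof.
move=> sep [S1 [sz1 H1]] [S2 [sz2 H2]]; exists (S1 ++ S2); split.
  by rewrite size_cat leq_add.
move=> y; rewrite !mem_cat negb_or => yw /andP[y1 y2].
case/orP: yw => [yw|yw].
- have [p [x [q [wE yx Hz]]]] := H1 y yw y1.
  exists p, x, (q ++ w2); split=> // [|z]; first by rewrite wE -catA.
  rewrite mem_cat => /orP[/Hz //|zw].
  have xw : x \in w1 by rewrite wE mem_cat !inE eqxx orbT.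
  by case: sep => sep; move: (sep _ _ xw zw) (sep _ _ yw zw); lia.
- have [p [x [q [wE yx Hz]]]] := H2 y yw y2.
  exists (w1 ++ p), x, q; split=> // [|z]; first by rewrite wE -catA.
  rewrite mem_cat => /orP[zw|/Hz //].
  have xw : x \in w2 by rewrite wE mem_cat !inE eqxx orbT.
  by case: sep => sep; move: (sep _ _ zw xw) (sep _ _ zw yw); lia.
Qed.

(** A new letter [z] disturbs at most three letters: itself, the letter placed right after it, and
    the letter next below it in value. *)
Lemma few_runs_insert C p z q :
  few_runs C (p ++ q) -> few_runs (C + 3) (p ++ z :: q).
Proof.
move=> [S [szS HS]]; pose m := \max_(y <- p ++ q | y < z) y.
exists [:: z, head z q, m & S]; split; first by rewrite /= addn3.
move=> y yw; rewrite !inE !negb_or => /and4P[yz yq ym yS].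
have /HS/(_ yS) [p' [x [q' [wE yx Hz]]]] : y \in p ++ q.
  by move: yw; rewrite !mem_cat !inE (negPf yz).
have yE : y \in p ++ q by rewrite wE mem_cat !inE eqxx !orbT.
have zxy : ~~ (y < z < x).
  apply/negP => /andP[yltz zltx]; case/eqP: ym; apply/eqP.
  rewrite eqn_leq; apply/andP; split; first exact: leq_bigmax_seq.
  apply/bigmax_leqP_seq => t tw tz; have := Hz t tw; lia.
have Hz' : forall t, t \in p ++ z :: q -> ~~ (y < t < x).
  move=> t; rewrite mem_cat inE orbCA => /orP[/eqP -> //|].
  by rewrite -mem_cat; apply: Hz.
have [lt|ge] := ltnP (size p') (size p).
- have pE : take (size p) (p' ++ [:: x, y & q']) = p by rewrite -wE take_size_cat.
  have qE : drop (size p) (p' ++ [:: x, y & q']) = q by rewrite -wE drop_size_cat.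
  move: pE qE; rewrite take_cat drop_cat ltnNge (ltnW lt) /=.
  (* The difference is 1 exactly when [x] ends [p] and [y] heads [q], the case excluded by [yq];
     otherwise both letters lie in [p]. *)
  case: (size p - size p') (subn_gt0 (size p') (size p)) => [|[|j]].
  + by rewrite lt.
  + by move=> _ _ qE; rewrite -qE /= eqxx in yq.
  + move=> _ /= pE qE; exists p', x, (take j q' ++ z :: drop j q').
    by split=> //; rewrite -[in LHS]pE -[in LHS]qE -catA.
- exists (p ++ z :: drop (size p) p'), x, q'; split=> //.
  rewrite -catA /= ; congr (_ ++ _ :: _).
  have := congr1 (drop (size p)) wE; rewrite drop_size_cat // => ->.
  rewrite drop_cat; case: ltngtP ge => // E _.
  by rewrite E subnn drop0 drop_size.
Qed.

(** The deleted letters of [q] are put back one at a time, at a cost of three each. *)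
Lemma few_runs_filter C (c : pred nat) p q :
  few_runs C (p ++ filter c q) ->
  few_runs (C + 3 * count (predC c) q) (p ++ q).
Proof.
elim: q p C => [|z q IH] p C /=; first by rewrite muln0 addn0.
case: (c z) => /= H; rewrite -cat_rcons.
  by apply: IH; rewrite cat_rcons.
rewrite mulnDr addnA; apply: IH; rewrite cat_rcons.
exact: few_runs_insert.
Qed.

(* Within a maximal block of leading maxima only the first letter starts a run. *)
Lemma few_runs_leading_max (Q : seq nat -> Prop) C :
  (forall x w, Q (x :: w) -> Q w) ->
  (forall x w, Q (x :: w) -> has (gtn^~ x) w -> few_runs C (x :: w)) ->
  forall w, uniq w -> Q w -> few_runs C.+1 w.
Proof.
move=> Qtl Qnmax w Uw Qw.
(* The induction also needs the first letter to be listed; [take 1] makes this vacuous for the empty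
   word. *)
suff: exists S, [/\ size S <= C.+1, forall y, y \in w -> y \notin S -> good w y
  & all (mem S) (take 1 w)] by case=> S [? ? _]; exists S.
elim: w Uw Qw => [|x w IH]; first by exists [::].
rewrite [uniq _]/= => /andP[xw Uw] Qw.
have Qnmax' y w' : Q (y :: w') -> has (gtn^~ y) w' ->
  exists S, [/\ size S <= C.+1,
     forall z, z \in y :: w' -> z \notin S -> good (y :: w') z
     & y \in S].
  move=> Qy /Qnmax -/(_ Qy) [S [szS HS]]; exists (y :: S); split=> //.
    by move=> z zw; rewrite inE negb_or => /andP[_]; apply: HS.
  exact: mem_head.
have [/(Qnmax' _ _ Qw) [S [? ? ?]]|/hasPn xmax] := boolP (has (gtn^~ x) w).
  by exists S; rewrite /= take0 andbT.
case: w => [|y w] in IH xw Uw Qw xmax *.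
  by exists [:: x]; split; rewrite /= ?inE ?eqxx //; move=> y ->.
have ltyx z : z \in y :: w -> z < x.
  move=> zw; have := xmax z zw; have : z != x by apply: contraNneq xw => <-.
  by rewrite /=; lia.
have good_cons z : good (y :: w) z -> good (x :: y :: w) z.
  move=> [p [x' [q [wE lt Hz]]]]; exists (x :: p), x', q.
  split=> // [|t]; first by rewrite wE.
  rewrite inE => /orP[/eqP ->|/Hz //].
  by have := ltyx x'; rewrite wE mem_cat !inE eqxx orbT => /(_ isT); lia.
have [yn|/hasPn ymax] := boolP (has (gtn^~ y) w).
  have [S [szS HS]] := Qnmax _ _ (Qtl _ _ Qw) yn.
  exists (x :: S); split; rewrite /= ?inE ?eqxx //.
  move=> z; rewrite !inE negb_or => /predU1P[->|zw]; first by rewrite eqxx.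
  by case/andP=> _ zS; apply/good_cons/HS.
have [S [szS HS]] := IH Uw (Qtl _ _ Qw).
(* Here [x] and [y] are the two largest letters and adjacent, so [y] continues a run and [x]
   replaces it in [S] without changing the size. *)
rewrite /= take0 andbT => yS; exists (x :: rem y S); split.
- by rewrite /= size_rem // prednK //; case: (S) yS.
- move=> z; rewrite !inE negb_or => zw /andP[zx zS].
  case/predU1P: zw zx => [->|zw _]; first by rewrite eqxx.
  have [->|zy] := eqVneq z y.
    exists [::], x, w; split=> // [|t]; first exact/ltyx/mem_head.
    rewrite !inE => /or3P[/eqP ->|/eqP ->|tw]; rewrite ?ltnn ?andbF //.
    by have := ymax t tw; rewrite /=; lia.
  apply/good_cons/HS; first by rewrite inE.
  apply: contraNN zS => zS.
  by move: zS; rewrite (perm_mem (perm_to_rem yS)) inE (negPf zy).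
- by rewrite /= !inE eqxx.
Qed.

Lemma few_runs_no_swap k : exists C, forall w, uniq w -> ~ has_swap k w ->
  few_runs C w.
Proof.
elim: k => [|k [Ck IHk]].
  (* For [k = 0] the pattern is 21, and [x y y x] contains both orders of [x] and [y]; hence [w] has
     at most one letter. *)
  exists 1 => w Uw nsw; case: w Uw nsw => [|x [|y w]]; rewrite ?[uniq _]/=.
  - by move=> _ _; exists [::].
  - by move=> _ _; exists [:: x]; split=> // y ->.
  rewrite inE negb_or -!andbA => /and3P[xy _ _] nsw; case: nsw.
  apply: (@has_swap_subseq _ [:: x; y]); first by rewrite /= !eqxx sub0seq.
  have [lt|lt|E] := ltngtP x y; last by rewrite E eqxx in xy.
    exists [::], x, y; split=> //=; first by rewrite lt.
    by rewrite (gtn_eqF lt) !eqxx (ltn_eqF lt) ?eqxx.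
  by exists [::], y, x; split=> //=; rewrite ?lt ?eqxx.
(* The increasing word [e] above [w] records the letters [b] met so far. *)
suff inner j : exists C, forall w e, uniq w -> sorted ltn e -> size e + j = k.+3 ->
    (forall x y, x \in w -> y \in e -> x < y) -> ~ has_swap k.+1 (w ++ e) ->
    few_runs C w.
  have [C HC] := inner k.+3; exists C => w Uw nsw.
  by apply: (HC w [::]); rewrite ?cats0.
elim: j => [|j [Cj IHj]].
  (* Now [e] alone is an increasing word of length [k.+3], which already produces the pattern. *)
  exists 0 => w e _ se sze _ []; rewrite addn0 in sze.
  exact: has_swap_sorted se sze (suffix_subseq _ _).
(* The terms count [a]; the stretch [lam] before [b]; [b] with the later letters above [a]; the at
   most [2 ^ k.+1] later letters below [a], at three each; and one more for the leading maxima. *)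
exists (1 + Cj + Ck + 3 * 2 ^ k.+1).+1 => w e Uw se sze we nsw.
pose Q v := [/\ uniq v, (forall x y, x \in v -> y \in e -> x < y) &
  ~ has_swap k.+1 (v ++ e)].
apply: (few_runs_leading_max (Q := Q)) => // {w Uw we nsw} [x w|a w].
  rewrite /Q /= => -[/andP[_ Uw] we nsw]; split=> // [y z yw|].
    by apply: we; rewrite inE yw orbT.
  by apply: contra_not nsw; apply: has_swap_subseq; apply: subseq_cons.
case=> Uw we nsw nmax; case/split_find: nmax Uw we nsw => b lam q /= ab nlam.
rewrite cat_rcons /= mem_cat inE !negb_or cat_uniq /=.
case/and5P=> /and3P[alam aNb aq] Ulam /norP[blam lamq] bq Uq we nsw.
have lt_lam y : y \in lam -> y < a.
  move=> yl; have := hasPn nlam y yl; rewrite /= -leqNgt leq_eqVlt.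
  by case/predU1P=> // E; rewrite -E yl in alam.
have few_small : count (gtn a) q <= 2 ^ k.+1.
  rewrite leqNgt; apply/negP => lt; case: nsw.
  apply: (@has_swap_subseq _ (a :: b :: filter (gtn a) q)).
    rewrite -catA /= eqxx; apply: subseq_trans (suffix_subseq _ _).
    by rewrite /= eqxx -[filter _ _]cats0 cat_subseq ?filter_subseq ?sub0seq.
  apply: has_swap_below; rewrite ?filter_all ?filter_uniq ?size_filter //.
  exact: ltnW.
have Plam : few_runs Cj lam.
  apply: (IHj lam (b :: e)) => //.
  - rewrite /= path_sortedE ?se ?andbT; last exact: ltn_trans.
    by apply/allP => y; apply: we; rewrite !(inE, mem_cat) eqxx !orbT.
  - by rewrite /= addSn -addnS.
  - move=> x y xl; rewrite inE => /predU1P[->|]; first exact: ltn_trans (lt_lam x xl) ab.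
    by apply: we; rewrite inE mem_cat xl orbT.
  - apply: contra_not nsw; apply: has_swap_subseq.
    apply: subseq_trans (subseq_cons _ _); rewrite -catA cat_subseq //=.
    by rewrite eqxx suffix_subseq.
(* An occurrence for [k] among letters above [a] becomes one for [k.+1] when [a] is put in front. *)
have Pgam : few_runs Ck (b :: filter (ltn a) q).
  apply: IHk; first by rewrite /= filter_uniq // mem_filter negb_and bq orbT.
  move=> sw; apply: nsw; apply: (@has_swap_subseq _ (a :: b :: q)).
    rewrite /= eqxx -catA; apply: subseq_trans (suffix_subseq _ _).
    by rewrite /= eqxx prefix_subseq.
  by apply: has_swap_cons; rewrite /= ab.
have Pmain : few_runs (1 + Cj + Ck) ((a :: lam) ++ b :: filter (ltn a) q).
  apply: few_runs_cat => //.
    left=> x y; rewrite !inE mem_filter => xl yl.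
    have xa : x <= a by case/predU1P: xl => [->//|/lt_lam/ltnW].
    by apply: leq_ltn_trans xa _; case/predU1P: yl => [->//|/andP[]].
  apply: (few_runs_cat (w1 := [:: a])) => //; last exact: (few_runs_size [:: a]).
  by right=> x y; rewrite inE => /eqP-> /lt_lam.
have -> : a :: lam ++ b :: q = rcons (a :: lam) b ++ q by rewrite cat_rcons.
rewrite -cat_rcons in Pmain.
apply: few_runs_le (few_runs_filter Pmain); rewrite leq_add2l leq_mul2l.
apply: leq_trans few_small; apply: eq_leq; apply: eq_in_count => y yq /=.
by rewrite -leqNgt leq_eqVlt orb_idl // => /eqP E; rewrite -E yq in aq.
Qed.

(** * Occurrences of patterns in words *)

Definition word n (pi : 'S_n) : seq nat := [seq val (pi i) | i <- enum 'I_n].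

Lemma size_word n (pi : 'S_n) : size (word pi) = n.
Proof. by rewrite size_map size_enum_ord. Qed.

Lemma nth_word n (pi : 'S_n) (i : 'I_n) : nth 0 (word pi) i = pi i.
Proof. by rewrite (nth_map i) ?size_enum_ord // nth_ord_enum. Qed.

Lemma word_inj n : injective (@word n).
Proof. by move=> p q E; apply/permP => i; apply/val_inj; rewrite /= -!nth_word E. Qed.

Lemma word_uniq n (pi : 'S_n) : uniq (word pi).
Proof.
by rewrite map_inj_uniq ?enum_uniq // => i j /val_inj /perm_inj.
Qed.

Lemma perm_eq_word n (pi : 'S_n) : perm_eq (word pi) (iota 0 n).
Proof.
have sub : {subset word pi <= iota 0 n}.
  by move=> _ /mapP[i _ ->]; rewrite mem_iota /=.
have [|_ mem] := uniq_min_size (word_uniq pi) sub.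
  by rewrite size_word size_iota.
exact: uniq_perm (word_uniq pi) (iota_uniq _ _) mem.
Qed.

Lemma word_surj n (w : seq nat) : perm_eq w (iota 0 n) ->
  exists pi : 'S_n, word pi = w.
Proof.
move=> wE; have szw : size w = n by rewrite (perm_size wE) size_iota.
have Uw : uniq w by rewrite (perm_uniq wE) iota_uniq.
have lt (i : 'I_n) : nth 0 w i < n.
  have : nth 0 w i \in w by rewrite mem_nth ?szw.
  by rewrite (perm_mem wE) mem_iota.
pose f i := Ordinal (lt i).
have finj : injective f.
  move=> i j /(congr1 val) /= /eqP; rewrite nth_uniq ?szw // => /eqP.
  exact: val_inj.
exists (perm finj); apply: (@eq_from_nth _ 0); rewrite ?size_word // => i ltin.
by rewrite -[i]/(val (Ordinal ltin)) nth_word permE.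
Qed.

Lemma rev_enum_ord n : rev (enum 'I_n) = map (@rev_ord n) (enum 'I_n).
Proof.
apply: (inj_map val_inj); rewrite map_rev val_enum_ord.
apply: (@eq_from_nth _ 0) => [|i]; rewrite size_rev size_iota.
  by rewrite 2!size_map size_enum_ord.
move=> ltin; rewrite nth_rev ?size_iota // nth_iota ?add0n; last by lia.
rewrite (nth_map (Ordinal ltin)) 1?size_map ?size_enum_ord //.
by rewrite (nth_map (Ordinal ltin)) ?size_enum_ord //= nth_enum_ord.
Qed.

Lemma word_reversal n (pi : 'S_n) : word (reversal pi) = rev (word pi).
Proof.
by rewrite -map_rev rev_enum_ord -map_comp; apply: eq_map => i; rewrite /= permE.
Qed.

Lemma tval_rev_double n (pi : 'S_n) :
  map val (rev_double pi) = doubled (word pi).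
Proof.
have E (p : 'S_n) : map val (perm_word p) = word p by rewrite -map_comp.
by rewrite /= map_cat -!/(perm_word _) !E word_reversal.
Qed.

Lemma subseq_index (s : seq nat) (js : seq nat) : sorted ltn js ->
  all (gtn (size s)) js -> subseq (map (nth 0 s) js) s.
Proof.
move=> js_s /allP js_lt; have sE := mkseq_nth 0 s.
rewrite -{2}sE; apply: map_subseq.
apply/subseqP; exists (map (mem js) (iota 0 (size s))).
  by rewrite size_map.
rewrite -filter_mask; apply: (irr_sorted_eq ltn_trans ltnn) => //.
  by apply: sorted_filter; [exact: ltn_trans|exact: iota_ltn_sorted].
move=> x; rewrite mem_filter mem_iota /=; case xj: (x \in js) => //=.
by apply/esym; exact: js_lt.
Qed.

Lemma indices_of_subseq (s t : seq nat) : subseq t s ->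
  exists js, [/\ sorted ltn js, all (gtn (size s)) js & t = map (nth 0 s) js].
Proof.
case/subseqP=> m szm ->; exists (mask m (iota 0 (size s))); split.
- exact: (sorted_mask ltn_trans)  (iota_ltn_sorted _ _).
- by apply/allP => x /mem_mask; rewrite mem_iota.
- by rewrite map_mask -/(mkseq _ _) mkseq_nth.
Qed.

(* [f] sends each letter of the pattern to the letter playing its role. *)
Lemma containsP m n k (w : m.-tuple 'I_n) (rho : 'S_k) :
  reflect (exists f : nat -> nat, (forall i j, i < j < k -> f i < f j) /\
            subseq (map f (word rho)) (map val w))
          (contains w rho).
Proof.
have nthw (j : 'I_m) : nth 0 (map val w) j = tnth w j.
  by rewrite (nth_map (tnth w j)) ?size_tuple // -tnth_nth.
apply: (iffP existsP).
- case=> i /andP[/forallP imon /forallP iord].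
  case: k rho i imon iord => [|k] rho i imon iord.
    exists id; split; first by move=> ? ? /andP[].
    by rewrite /word (size0nil (size_enum_ord 0)) sub0seq.
  (* The value [v] goes to the letter of the occurrence at the place where [rho] equals [v]; [inord]
     needs a successor bound, whence the separate empty pattern. *)
  exists (fun v => tnth w (i ((rho^-1)%g (inord v)))); split.
    move=> u v /andP[uv vk]; rewrite ltnNge.
    have /eqP-> := forallP (iord ((rho^-1)%g (inord v))) ((rho^-1)%g (inord u)).
    by rewrite !permKV !inordK ?(ltn_trans uv) // -ltnNge.
  have -> : [seq val (tnth w (i ((rho^-1)%g (inord v)))) | v <- word rho]
    = map (nth 0 (map val w)) (map val (map i (enum 'I_k.+1))).
    rewrite -!map_comp; apply: eq_map => a /=.
    by rewrite inord_val permK nthw.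
  apply: subseq_index; last first.
    by apply/allP => _ /mapP[j _ ->]; rewrite size_map size_tuple /=.
  rewrite -map_comp sorted_map.
  have := iota_ltn_sorted 0 k.+1; rewrite -val_enum_ord sorted_map.
  by apply: sub_sorted => a b /= ab; apply: (implyP (forallP (imon a) b)).
- case=> f [fmon /indices_of_subseq[js [sj ltj E]]].
  have szj : size js = k by have := congr1 size E; rewrite size_map size_word size_map.
  have jlt (a : 'I_k) : nth 0 js a < m.
    have : nth 0 js a \in js by rewrite mem_nth ?szj.
    by move/(allP ltj); rewrite /= size_map size_tuple.
  pose i := [ffun a : 'I_k => Ordinal (jlt a)].
  have wi a : tnth w (i a) = f (rho a) :> nat.
    rewrite -nthw ffunE /= -(nth_map 0 0 (nth 0 (map val w))) ?szj // -E.
    by rewrite (nth_map 0) ?size_word // nth_word.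
  exists i; apply/andP; split; apply/forallP => a; apply/forallP => b.
    apply/implyP => ab; rewrite !ffunE /=.
    by apply: (sorted_ltn_nth ltn_trans); rewrite ?inE ?szj.
  rewrite !wi; have [lt|le] := ltnP (rho b) (rho a).
    by rewrite leqNgt fmon // lt /=.
  case: ltngtP le => // [lt|/val_inj ->] _; last by rewrite leqnn.
  by rewrite ltnW // fmon // lt /=.
Qed.

Lemma contains_doubleP n k (pi : 'S_n) (rho : 'S_k) :
  reflect (exists f : nat -> nat, (forall i j, i < j < k -> f i < f j) /\
            subseq (map f (word rho)) (doubled (word pi)))
          (contains (rev_double pi) rho).
Proof. by rewrite -tval_rev_double; apply: containsP. Qed.

Lemma rev_double_inj n : injective (@rev_double n).
Proof.
move=> p q /(congr1 (fun t : _.-tuple _ => map val t)).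
rewrite !tval_rev_double => /eqP; rewrite eqseq_cat ?size_word // => /andP[/eqP E _].
exact: word_inj E.
Qed.

Lemma r_countE k (rho : 'S_k) n :
  r_count rho n = #|[set pi : 'S_n | avoids (rev_double pi) rho]|.
Proof.
rewrite -(card_imset _ (@rev_double_inj n)); apply: eq_card => w.
rewrite inE; apply/andP/imsetP => [[/imsetP[pi _ ->] av]|[pi]].
  by exists pi; rewrite ?inE.
by rewrite inE => av ->; split=> //; apply: imset_f.
Qed.

(** * Symmetries of the pattern *)

Lemma reversalK n : involutive (@reversal n).
Proof. by move=> p; apply/permP => i; rewrite !permE /= permE /= rev_ordK. Qed.

Lemma complementK n : involutive (@complement n).
Proof. by move=> p; apply/permP => i; rewrite !permE /= permE /= rev_ordK. Qed.

(** A doubled word is a palindrome, so it contains a pattern together with its reversal. *)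
Lemma r_count_reversal k (rho : 'S_k) n :
  r_count (reversal rho) n = r_count rho n.
Proof.
suff sub (tau : 'S_k) (pi : 'S_n) : contains (rev_double pi) tau ->
    contains (rev_double pi) (reversal tau).
  rewrite !r_countE; apply: eq_card => pi; rewrite !inE /avoids; congr negb.
  by apply/idP/idP => /sub //; rewrite reversalK.
move=> /contains_doubleP[f [fmon sub]]; apply/contains_doubleP; exists f.
split=> //; rewrite word_reversal map_rev.
by rewrite -[doubled _]revK subseq_rev rev_cat revK.
Qed.

(** Complementing [pi] complements its doubled word, which gives a bijection between the two sets of
    avoiders. *)
Lemma r_count_complement k (rho : 'S_k) n :
  r_count (complement rho) n = r_count rho n.
Proof.
have avE (pi : 'S_n) :
    avoids (rev_double (complement pi)) (complement rho) = avoids (rev_double pi) rho.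
  congr negb; apply: eq_existsb => i; congr andb.
  have tE j : tnth (rev_double (complement pi)) j = rev_ord (tnth (rev_double pi) j).
    suff -> : rev_double (complement pi) = map_tuple (@rev_ord n) (rev_double pi).
      by rewrite tnth_map.
    apply: val_inj; rewrite /= map_cat -!map_comp.
    by congr cat; apply: eq_map => i'; rewrite /= !permE /= ?permE.
  have revE m (x y : 'I_m) : (rev_ord x <= rev_ord y) = (y <= x).
    by rewrite /=; have := ltn_ord x; have := ltn_ord y; lia.
  apply/forallP/forallP => H a; apply/forallP => b.
    by have := forallP (H b) a; rewrite !tE !permE /= !revE.
  by have := forallP (H b) a; rewrite !tE !permE /= !revE.
rewrite !r_countE -(card_imset _ (can_inj (@complementK n))).
apply: eq_card => pi; apply/imsetP/idP => [[p]|]; rewrite inE.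
  by move=> av ->; rewrite inE -avE complementK.
by rewrite -avE => av; exists (complement pi); rewrite ?complementK ?inE.
Qed.

(** * Counting the permutations with few runs *)

(* [c] lists, with [None] as padding, points of the graph of [pi], including  *)
(* the first point of every run; such a list determines [pi].                 *)
Definition run_code n C (pi : 'S_n) (c : C.-tuple (option ('I_n * 'I_n))) :=
  [forall i, (Some (i, pi i) \in c) ||
     [exists j : 'I_n, (j.+1 == i) && (pi j == (pi i).+1 :> nat)]] &&
  [forall i, forall v, (Some (i, v) \in c) ==> (pi i == v)].

(** Reading from left to right, each value is either listed in [c] or one less than the value before
    it. *)
Lemma run_code_inj n C (pi pi' : 'S_n) (c : C.-tuple (option ('I_n * 'I_n))) :
  run_code pi c -> run_code pi' c -> pi = pi'.
Proof.
case/andP=> /forallP st /forallP cs; case/andP=> /forallP st' /forallP cs'.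
suff eq m (i : 'I_n) : i < m -> pi i = pi' i.
  by apply/permP => i; apply: (eq n).
elim: m i => // m IH i; rewrite ltnS => im.
case/orP: (st i) => [/(implyP (forallP (cs' i) _))/eqP-> //|].
case/orP: (st' i) => [/(implyP (forallP (cs i) _))/eqP-> //|].
case/existsP=> j /andP[/eqP ji /eqP pj] /existsP[j' /andP[/eqP ji' /eqP pj']].
have jj : j' = j by apply: val_inj; move: ji; rewrite /= -ji' => -[].
apply: val_inj => /=; move: pj' pj; rewrite jj IH; last by rewrite -ji in im.
by move=> ->; case.
Qed.

Lemma few_runs_code n C (pi : 'S_n) : few_runs C (word pi) ->
  exists c : C.-tuple _, run_code pi c.
Proof.
move=> [S [szS HS]].
pose pt y : option ('I_n * 'I_n) := omap (fun v => ((pi^-1)%g v, v)) (insub y).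
(* The default [n] lies outside ['I_n], so [pt] turns positions past the end of [S] into [None]. *)
exists [tuple pt (nth n S j) | j < C]; apply/andP; split; apply/forallP => i.
- have iw : val (pi i) \in word pi by rewrite (perm_mem (perm_eq_word pi)) mem_iota /=.
  case: (boolP (val (pi i) \in S)) => [iS|/(HS _ iw)[p [x [q [wE lt Hz]]]]].
    apply/orP; left; apply/mapP.
    have ltj : index (val (pi i)) S < C by rewrite (leq_trans _ szS) ?index_mem.
    exists (Ordinal ltj); first by rewrite mem_enum.
    by rewrite /= nth_index // /pt valK /= permK.
  apply/orP; right; apply/existsP.
  have szw := size_word pi; rewrite wE size_cat /= in szw.
  have ltp : size p < n by rewrite -szw; lia.
  have ltp1 : (size p).+1 < n by rewrite -szw; lia.
  have px : pi (Ordinal ltp) = x :> nat.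
    by rewrite -nth_word wE nth_cat /= ltnn subnn.
  have py : pi (Ordinal ltp1) = pi i.
    by apply: val_inj; rewrite /= -nth_word wE nth_cat /= ltnNge leqnSn /= subSnn.
  have iE : (size p).+1 == i by rewrite -(perm_inj py).
  exists (Ordinal ltp); rewrite iE px /=; apply/eqP.
  (* The value [(pi i).+1] occurs in the word; as nothing lies strictly between [pi i] and [x], it
     is [x]. *)
  have xn : (pi i).+1 < n by apply: leq_ltn_trans lt _; rewrite -px ltn_ord.
  have : (pi i).+1 \in word pi by rewrite (perm_mem (perm_eq_word pi)) mem_iota.
  by move/Hz; rewrite ltnSn /= -leqNgt; move: lt; rewrite /=; lia.
- apply/forallP => v; apply/implyP => /mapP[j _].
  by rewrite /pt; case: insubP => //= u _ _ [-> ->]; rewrite permKV.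
Qed.

Lemma card_few_runs n C (A : {set 'S_n}) :
  (forall pi, pi \in A -> few_runs C (word pi)) -> #|A| <= (n * n).+1 ^ C.
Proof.
move=> HA; pose code (pi : 'S_n) : C.-tuple (option ('I_n * 'I_n)) :=
  odflt [tuple None | _ < C] [pick c | run_code pi c].
have codeP pi : pi \in A -> run_code pi (code pi).
  move=> /HA/few_runs_code[c piC]; rewrite /code.
  by case: pickP => // /(_ c); rewrite piC.
have <- : #|{: C.-tuple (option ('I_n * 'I_n))}| = (n * n).+1 ^ C.
  by rewrite card_tuple card_option card_prod card_ord.
rewrite -(card_in_imset (f := code)) ?max_card // => p q /codeP pA /codeP qA E.
by apply: run_code_inj pA _; rewrite E.
Qed.

Lemma few_runs_polynomial_growth (R : archiRealFieldType) k (rho : 'S_k) C :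
  (forall n (pi : 'S_n), avoids (rev_double pi) rho -> few_runs C (word pi)) ->
  polynomial_growth R (r_count rho).
Proof.
move=> H; exists (('X * 'X + 1) ^+ C)%R => n.
rewrite horner_exp !hornerE -natrM natr1 -natrX ler_nat r_countE.
by apply: card_few_runs => pi; rewrite inE; apply: H.
Qed.

(** * Polynomial growth of the two patterns *)

Lemma word_one k : word (perm_one 'I_k) = iota 0 k.
Proof.
by rewrite -val_enum_ord; apply: eq_map => i; rewrite permE.
Qed.

Lemma word_swap_last k : word (swap_last k.+2) = iota 0 k ++ [:: k.+1; k].
Proof.
apply: (@eq_from_nth _ 0); first by rewrite size_word size_cat size_iota addn2.
move=> i; rewrite size_word => ltik; rewrite -[i]/(val (Ordinal ltik)) nth_word /=.
rewrite nth_cat size_iota; case: tpermP => [/(congr1 val)|/(congr1 val)|ne1 ne2] /=.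
- by rewrite inordK // => ->; rewrite ltnn subnn.
- by move=> ->; rewrite ltnNge leqnSn /= subSnn /= inordK.
have ni : i != k by apply/eqP => E; apply: ne1; apply: val_inj; rewrite /= inordK.
have ni' : i != k.+1 by apply/eqP => E; apply: ne2; apply: val_inj.
have ik : i < k by rewrite ltn_neqAle ni -ltnS ltn_neqAle ni' -ltnS.
by rewrite ik nth_iota.
Qed.

(** An avoiding word has at most [2 ^ k] letters, and all of them may be counted as starting
    runs. *)
Lemma growth_one (R : archiRealFieldType) k :
  polynomial_growth R (r_count (perm_one 'I_k)).
Proof.
apply: (@few_runs_polynomial_growth _ _ _ (2 ^ k)) => n pi /negP av.
apply: few_runs_le (few_runs_size _); rewrite leqNgt; apply/negP => /ltnW ge.
have [t [szt st sub]] := sorted_in_doubled (word_uniq pi) ge.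
apply/av/contains_doubleP; exists (nth 0 t); split.
  move=> i j /andP[ij jk]; apply: (sorted_ltn_nth ltn_trans); rewrite ?inE ?szt //.
  exact: ltn_trans jk.
by rewrite word_one -szt -/(mkseq _ _) mkseq_nth.
Qed.

Lemma growth_swap_last (R : archiRealFieldType) k :
  polynomial_growth R (r_count (swap_last k)).
Proof.
case: k => [|[|k]]; [exact: growth_one|exact: growth_one|].
have [C HC] := few_runs_no_swap k.
apply: (@few_runs_polynomial_growth _ _ _ C) => n pi /negP av.
apply: HC; first exact: word_uniq.
case=> s [a [b [szs ss sub]]]; apply/av/contains_doubleP.
exists (nth 0 (s ++ [:: a; b])); split.
  have sz : size (s ++ [:: a; b]) = k.+2 by rewrite size_cat szs addn2.
  move=> i j /andP[ij jk]; apply: (sorted_ltn_nth ltn_trans); rewrite ?inE ?sz //.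
  exact: ltn_trans jk.
suff -> : map (nth 0 (s ++ [:: a; b])) (word (swap_last k.+2)) = s ++ [:: b; a] by [].
rewrite word_swap_last map_cat /= !nth_cat szs ltnn ltnNge leqnSn subSnn subnn /=.
congr cat; rewrite -[RHS](mkseq_nth 0) szs; apply/eq_in_map => i.
by rewrite mem_iota nth_cat szs /= => ->.
Qed.

(** * Subsequences of doubled words with distinct letters *)

Lemma mem_subseq_double (t w : seq nat) : subseq t (doubled w) -> {subset t <= w}.
Proof. by move=> /mem_subseq s x /s; rewrite mem_cat mem_rev orbb. Qed.

(** The letter [x] occurs only at the two ends of the doubled word, and [t] uses at most one of
    these copies. *)
Lemma subseq_double_cons (x : nat) w t : uniq (x :: w) -> uniq t ->
  subseq t (doubled (x :: w)) ->
  [\/ subseq t (doubled w),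
      exists2 t', t = x :: t' & subseq t' (doubled w) |
      exists2 t', t = rcons t' x & subseq t' (doubled w)].
Proof.
move=> /= /andP[xw Uw] Ut.
have dE : doubled (x :: w) = rcons (x :: doubled w) x by rewrite rev_cons -rcons_cat.
have xd : x \notin doubled w by rewrite mem_cat mem_rev orbb.
have rc (s u : seq nat) : uniq s -> subseq s (rcons u x) ->
   subseq s u \/ exists2 s', s = rcons s' x & subseq s' u.
  move=> Us; rewrite -subseq_rev rev_rcons.
  case/lastP: s Us => [|s y]; first by left; apply: sub0seq.
  rewrite rev_rcons /=; case: eqP => [-> _ s_u|_ _ s_u].
    by right; exists s; rewrite // -subseq_rev.
  by left; rewrite -subseq_rev rev_rcons.
rewrite -[X in is_true X]/(subseq t (doubled (x :: w))) dE => /(rc _ _ Ut).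
case=> [|[t' tE sub]].
  case: t Ut => [|y t] /=; first by move=> *; constructor 1; apply: sub0seq.
  by case: eqP => [-> _ sub|_ _ sub]; [constructor 2; exists t|constructor 1].
constructor 3; exists t' => //; case: t' tE sub => [|y t'] tE /=.
  by rewrite sub0seq.
by case: eqP => // yx; move: Ut; rewrite tE yx /= mem_rcons mem_head.
Qed.

Lemma subseq_catP (t u v : seq nat) : subseq t (u ++ v) ->
  exists a b, [/\ t = a ++ b, subseq a u & subseq b v].
Proof.
elim: u t => [|x u IH] t /=; first by exists [::], t.
case: t => [|y t]; first by exists [::], [::]; rewrite sub0seq.
case: eqP => [->|_] /IH[a [b [E au bv]]].
  by exists (x :: a), b; rewrite E /= eqxx.
by exists a, b; split=> //; apply: subseq_trans au (subseq_cons _ _).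
Qed.

(** The two copies of [z] are adjacent in the middle; using one of them splits [t] between [w] and
    [rev w]. *)
Lemma subseq_double_rcons (z : nat) w t : uniq t -> subseq t (doubled (rcons w z)) ->
  subseq t (doubled w) \/
  exists a b, [/\ t = a ++ z :: b, subseq a w & subseq b (rev w)].
Proof.
move=> Ut; have -> : doubled (rcons w z) = w ++ [:: z; z] ++ rev w.
  by rewrite rev_rcons -cats1 -catA.
case/subseq_catP=> a [r [tE aw /subseq_catP[c [b [rE cz bw]]]]]; subst r.
have cmem := mem_subseq cz; case: c => [|y c] in tE cz cmem.
  by left; rewrite tE cat_subseq.
have yz : y = z by have := cmem y (mem_head _ _); rewrite !inE orbb => /eqP.
case: c => [|y' c] in tE cz cmem *; first by right; exists a, b; rewrite tE yz.
have yz' : y' = z.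
  by have := cmem y'; rewrite !inE eqxx !orbT => /(_ isT); rewrite orbb => /eqP.
by move: Ut; rewrite tE yz yz' cat_uniq /= inE eqxx !andbF.
Qed.

(** * Three classes of words *)

(* Each letter is the minimum or the maximum of the letters from it onwards. *)
Definition extremal_suffix w := forall a b c : nat,
  subseq [:: a; b; c] w -> (a < b) = (a < c).

(* Each letter is the minimum or the maximum of the letters up to it. *)
Definition extremal_prefix w := forall a b c : nat,
  subseq [:: a; b; c] w -> (a < c) = (b < c).

(* The skew sums of decreasing words and of words [12]. *)
Definition skew_layered w := forall a b c : nat,
  subseq [:: a; b; c] w -> c < a.

(** The first letter of [w] used by [t] stands at an end of [t], and is extremal among all letters
    that follow it in [w]. *)
Lemma extremal_suffix_ends w t : uniq w -> extremal_suffix w -> uniq t ->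
  0 < size t -> subseq t (doubled w) ->
  exists x t', (t = x :: t' \/ t = rcons t' x) /\ (all (ltn x) t' \/ all (gtn x) t').
Proof.
move=> + + Ut sz; elim: w => [|x w IH] Uw Ww.
  by rewrite subseq0 => /eqP E; rewrite E in sz.
have Ww' : extremal_suffix w.
  by move=> a b c abc; apply: Ww; apply: subseq_trans abc (subseq_cons _ _).
have ext t' : subseq t' (doubled w) -> all (ltn x) t' \/ all (gtn x) t'.
  move=> /mem_subseq_double sub.
  case: w Uw Ww sub {IH Ww'} => [|y w] /andP[xw _] Ww sub.
    by left; apply/allP => z /sub.
  have xE z : z \in y :: w -> (x < z) = (x < y).
    rewrite inE => /predU1P[->//|zw]; apply/esym/Ww.
    by rewrite /= !eqxx sub1seq.
  have xz z : z \in y :: w -> z != x by move=> zw; apply: contraNneq xw => <-.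
  case lt: (x < y); [left|right]; apply/allP => z /sub zw; have := xE z zw.
    by rewrite lt.
  by rewrite lt /=; have := xz z zw; lia.
case/(subseq_double_cons Uw Ut).
- by apply: IH => //; case/andP: Uw.
- by move=> [t' tE /ext H]; exists x, t'; split=> //; left.
- by move=> [t' tE /ext H]; exists x, t'; split=> //; right.
Qed.

(** Only the letter right after [x] can exceed [x], and it stands at an end of [t] if it is used. *)
Lemma skew_layered_tail x w t : uniq (x :: w) -> skew_layered (x :: w) ->
  uniq t -> subseq t (doubled w) ->
  all (gtn x) t \/
  exists y t', [/\ t = y :: t' \/ t = rcons t' y, all (gtn x) t' & x < y].
Proof.
case: w => [|y w] Uw Ww Ut sub; first by left; move: sub; rewrite subseq0 => /eqP->.
have Hw s : subseq s (doubled w) -> all (gtn x) s.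
  move=> /mem_subseq_double ss; apply/allP => z /ss zw.
  by apply: (Ww _ y); rewrite /= !eqxx sub1seq.
have [xw Uyw] := andP Uw.
have xy : x != y by move: xw; rewrite inE negb_or => /andP[].
case/(subseq_double_cons Uyw Ut): sub => [/Hw|[s -> /Hw H]|[s -> /Hw H]].
- by left.
- have [lt|le] := ltnP x y; first by right; exists y, s; split=> //; left.
  by left; rewrite /= H andbT ltn_neqAle eq_sym xy.
- have [lt|le] := ltnP x y; first by right; exists y, s; split=> //; right.
  by left; rewrite all_rcons /= H andbT ltn_neqAle eq_sym xy.
Qed.

(** Let [x] be the first letter of [w] used by [t]. If some [y] above it is used, then [y] is either
    the maximum at the opposite end of [t] or the neighbour of [x] at the same end. *)
Lemma skew_layered_max w t : uniq w -> skew_layered w -> uniq t ->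
  0 < size t -> subseq t (doubled w) ->
  (exists x t', (t = x :: t' \/ t = rcons t' x) /\ all (gtn x) t') \/
  (exists x y t', [/\ t = [:: x, y & t'] \/ t = t' ++ [:: y; x],
     all (gtn x) t' & x < y]).
Proof.
move=> + + Ut sz; elim: w => [|x w IH] Uw Ww.
  by rewrite subseq0 => /eqP E; rewrite E in sz.
have Ww' : skew_layered w.
  by move=> a b c abc; apply: Ww; apply: subseq_trans abc (subseq_cons _ _).
have [xw Uw'] := andP Uw.
have lt_trans y s : x < y -> all (gtn x) s -> all (gtn y) s.
  by move=> xy; apply: sub_all => z /= zx; apply: ltn_trans zx xy.
case/(subseq_double_cons Uw Ut) => [|[t' tE]|[t' tE]]; first exact: IH.
- have Ut' : uniq t' by move: Ut; rewrite tE => /andP[].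
  case/(skew_layered_tail Uw Ww Ut') => [H|[y [s [[sE|sE] H xy]]]].
  + by left; exists x, t'; split=> //; left.
  + by right; exists x, y, s; split=> //; left; rewrite tE sE.
  + left; exists y, (x :: s); split; first by right; rewrite tE sE.
    by rewrite /= xy (lt_trans _ _ xy H).
- have Ut' : uniq t' by move: Ut; rewrite tE rcons_uniq => /andP[].
  case/(skew_layered_tail Uw Ww Ut') => [H|[y [s [[sE|sE] H xy]]]].
  + by left; exists x, t'; split=> //; right.
  + left; exists y, (rcons s x); split; first by left; rewrite tE sE.
    by rewrite all_rcons /= xy (lt_trans _ _ xy H).
  + by right; exists x, y, s; split=> //; right; rewrite tE sE -!cats1 -catA.
Qed.

(** A later letter [z] lies on the same side of [x] and of [y]: being below [x], it is below [y].
    The ascending case is symmetric. *)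
Lemma extremal_prefix_desc w x s : uniq w -> extremal_prefix w ->
  subseq (x :: s) w -> all (gtn x) s -> sorted gtn s.
Proof.
move=> Uw Hw; elim: s x => [|y s IH] x //= sub /andP[yx sx].
rewrite path_sortedE; last by move=> ? ? ? /=; lia.
have ysub := subseq_trans (subseq_cons _ _) sub.
have ys : all (gtn y) s.
  apply/allP => z zs; rewrite /= ltn_neqAle leqNgt -(Hw x y z).
    have /= /andP[ys _] := subseq_uniq ysub Uw; apply/andP; split.
      by apply: contraNneq ys => <-.
    by rewrite -leqNgt ltnW //; apply: (allP sx).
  by apply: subseq_trans sub; rewrite /= !eqxx sub1seq.
by rewrite ys /=; apply: (IH y).
Qed.

Lemma extremal_prefix_asc w x s : extremal_prefix w ->
  subseq (x :: s) w -> all (ltn x) s -> sorted ltn s.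
Proof.
move=> Hw; elim: s x => [|y s IH] x //= sub /andP[yx sx].
rewrite path_sortedE; last exact: ltn_trans.
have ysub := subseq_trans (subseq_cons _ _) sub.
have ys : all (ltn y) s.
  apply/allP => z zs; rewrite /= -(Hw x y z); first exact: (allP sx).
  by apply: subseq_trans sub; rewrite /= !eqxx sub1seq.
by rewrite ys /=; apply: (IH y).
Qed.

Lemma uniq_split (z : nat) a b a' b' : uniq (a ++ z :: b) ->
  a ++ z :: b = a' ++ z :: b' -> a = a' /\ b = b'.
Proof.
move=> U E; have notin c d : uniq (c ++ z :: d) -> index z (c ++ z :: d) = size c.
  rewrite cat_uniq /= negb_or => /and3P[_ /andP[zc _] _].
  by rewrite index_cat (negPf zc) /= eqxx addn0.
have sz : size a = size a' by rewrite -(notin a b) // E notin // -E.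
by move/eqP: E; rewrite eqseq_cat // => /andP[/eqP-> /eqP[->]].
Qed.

(* The last letter [z] of [w] occurs twice in the middle of [doubled w], and
   is the minimum or the maximum of [w]: if it occurs in the subsequence, then
   it is [x] or [y], which puts [s] on one side. *)
Lemma extremal_prefix_sorted w x s y e : uniq w -> extremal_prefix w ->
  uniq (x :: s ++ y :: e) -> all (ltn x) (s ++ y :: e) ->
  all (gtn y) s -> all (gtn y) e ->
  subseq (x :: s ++ y :: e) (doubled w) -> sorted ltn (x :: s).
Proof.
move=> + + Ut xt sy ey; elim/last_ind: w => [//|w z IH] Uw Hw.
have Uw' : uniq w by move: Uw; rewrite rcons_uniq => /andP[].
have Hw' : extremal_prefix w.
  by move=> a b c abc; apply: Hw; apply: subseq_trans abc (subseq_rcons _ _).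
case/(subseq_double_rcons Ut) => [/IH|]; first exact.
case=> a [b [tE aw bw]].
have xs : all (ltn x) s by move: xt; rewrite all_cat => /andP[].
have xlty : x < y by apply: (allP xt); rewrite mem_cat mem_head orbT.
rewrite /= path_sortedE ?xs /=; last exact: ltn_trans.
have ext : all (gtn z) w \/ all (ltn z) w.
  case: w Uw Hw {IH aw bw Uw' Hw'} => [|v w] Uw Hw; first by left.
  have vE u : u \in v :: w -> (u < z) = (v < z).
    rewrite inE => /predU1P[->//|uw]; apply/esym/Hw.
    by rewrite /= eqxx -cats1 (@cat_subseq _ [:: u] [:: z]) ?sub1seq ?mem_head.
  case lt: (v < z); [left|right]; apply/allP => u uw; have := vE u uw; rewrite lt //.
  move=> uz; rewrite /= ltn_neqAle leqNgt uz andbT.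
  by apply: contraTneq Uw => ->; rewrite rcons_uniq uw.
have zt : z \in x :: s ++ y :: e by rewrite tE mem_cat mem_head orbT.
have tw u : u \in x :: s ++ y :: e -> u \in w \/ u = z.
  rewrite tE mem_cat inE => /or3P[/(mem_subseq aw)|/eqP|/(mem_subseq bw)].
  - by left.
  - by right.
  - by rewrite mem_rev; left.
case: ext => /allP ext.
(* If [z] is the maximum, it plays [y]; then [x :: s] lies in the first half and ascends. *)
- have zy : z = y.
    have [||//] := tw y; first by rewrite inE mem_cat mem_head !orbT.
    move/ext; rewrite /= ltnNge => /negP[].
    move: zt; rewrite inE mem_cat inE => /or4P[/eqP->|/(allP sy)|/eqP->|/(allP ey)];
      by [|apply: ltnW].
  rewrite -zy -cat_cons in Ut tE; case: (uniq_split Ut tE) => aE _.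
  by rewrite -aE in aw; apply: (extremal_prefix_asc Hw') aw xs.
(* If [z] is the minimum, it plays [x], so the rest lies in [rev w]; hence [y :: rev s] is a
   subsequence of [w], and [rev s] descends. *)
- have zx : z = x.
    have [|xw|//] := tw x; first exact: mem_head.
    have := ext x xw; rewrite /= ltnNge => /negP[].
    by move: zt; rewrite inE => /predU1P[->//|/(allP xt)/ltnW].
  rewrite -zx in Ut tE; case: (@uniq_split _ [::] _ _ _ Ut tE) => _ bE.
  have sub : subseq (y :: rev s) w.
    rewrite -subseq_rev; apply: subseq_trans bw; rewrite -bE rev_cons revK.
    by rewrite -cats1 cat_subseq //= eqxx sub0seq.
  rewrite -[s]revK rev_sorted; apply: extremal_prefix_desc sub _ => //.
  by rewrite all_rev.
Qed.

(** * Exponential lower bounds *)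

Fixpoint suffix_word lo (bs : bitseq) : seq nat :=
  if bs is b :: bs' then
    if b then lo :: suffix_word lo.+1 bs'
    else lo + size bs :: suffix_word lo bs'
  else [:: lo].

Lemma perm_suffix_word lo bs : perm_eq (suffix_word lo bs) (iota lo (size bs).+1).
Proof.
elim: bs lo => [|b bs IH] lo //; case: b.
  by rewrite [suffix_word _ _]/= [iota _ _]/= perm_cons; apply: IH.
have -> : iota lo (size (false :: bs)).+1 = rcons (iota lo (size bs).+1) (lo + (size bs).+1).
  by rewrite -cats1 -[(size _).+1]addn1 iotaD.
by rewrite perm_sym perm_rcons perm_cons perm_sym; apply: IH.
Qed.

Lemma suffix_word_inj lo bs bs' : size bs = size bs' ->
  suffix_word lo bs = suffix_word lo bs' -> bs = bs'.
Proof.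
elim: bs bs' lo => [|b bs IH] [|b' bs'] lo //= [sz].
case: b b' => [] [] [] //.
- by move=> /IH ->.
- by lia.
- by lia.
- by move=> _ /IH ->.
Qed.

Lemma suffix_word_extremal lo bs : extremal_suffix (suffix_word lo bs).
Proof.
elim: bs lo => [|b bs IH] lo; first by move=> x y z /size_subseq.
have ext_cons x w : all (ltn x) w || all (gtn x) w -> extremal_suffix w ->
    extremal_suffix (x :: w).
  move=> xw Hw u v z /=; case: eqP => [->|_]; last exact: Hw.
  move=> /mem_subseq sub; have vw : v \in w by apply/sub/mem_head.
  have zw : z \in w by apply: sub; rewrite !inE eqxx orbT.
  case/orP: xw => /allP xw; first by rewrite [LHS]xw // [RHS]xw.
  by have := xw v vw; have := xw z zw; rewrite /=; lia.
case: b => /=; apply: ext_cons => //; apply/orP; [left|right];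
  apply/allP => y; rewrite (perm_mem (perm_suffix_word _ _)) mem_iota /=; lia.
Qed.

Lemma extremal_prefix_of_rev w : uniq w -> extremal_suffix w ->
  extremal_prefix (rev w).
Proof.
move=> Uw Hw a b c; rewrite -[[:: a; b; c]]revK subseq_rev => sub.
have := Hw c b a sub; have := subseq_uniq sub Uw.
by rewrite /= !inE; lia.
Qed.

(** Each bit orders a block of two consecutive values, and the blocks descend. *)
Fixpoint skew_word (bs : bitseq) : seq nat :=
  if bs is b :: bs' then
    let m := (size bs').*2 in
    (if b then [:: m; m.+1] else [:: m.+1; m]) ++ skew_word bs'
  else [::].

Lemma perm_skew_word bs : perm_eq (skew_word bs) (iota 0 (size bs).*2).
Proof.
elim: bs => [|b bs IH] //; rewrite [skew_word _]/=.
set m := (size bs).*2.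
have -> : iota 0 (size (b :: bs)).*2 = iota 0 m ++ [:: m; m.+1].
  by rewrite [size _]/= doubleS -/m -[m.+2]addn2 iotaD.
rewrite perm_sym perm_catC perm_sym perm_cat //.
by case: b => //; rewrite (perm_catC [:: m.+1] [:: m]).
Qed.

Lemma skew_word_inj bs bs' : size bs = size bs' ->
  skew_word bs = skew_word bs' -> bs = bs'.
Proof.
elim: bs bs' => [|b bs IH] [|b' bs'] //= [sz]; rewrite sz.
by case: b b' => [] [] [] // => [/IH ->|||/IH ->] //; lia.
Qed.

Lemma skew_word_layered bs : skew_layered (skew_word bs).
Proof.
elim: bs => [|b bs IH] x y z; first by move/size_subseq.
rewrite [skew_word _]/=; set m := (size bs).*2.
have lt u : u \in skew_word bs -> u < m.
  by rewrite (perm_mem (perm_skew_word _)) mem_iota.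
have tail v s : subseq (v :: s) (skew_word bs) -> last v s < m.
  by move=> /mem_subseq sub; apply/lt/sub/mem_last.
have H p q : m <= p -> m <= q -> subseq [:: x; y; z] [:: p, q & skew_word bs] -> z < x.
  move=> mp mq; rewrite [subseq _ _]/=.
  case: (x =P p) => [->|_].
    case: (y == q) => [/tail|/tail] zm; exact: leq_trans zm mp.
  case: (x =P q) => [-> /tail zm|_]; first exact: leq_trans zm mq.
  exact: IH.
by case: b; apply: H.
Qed.

(** * Exponential families against polynomial bounds *)

Lemma leq_exp_base m n e : m <= n -> m ^ e <= n ^ e.
Proof. by case: e => // e; rewrite leq_exp2r. Qed.

Lemma exp_dominates A d : exists m, A * (m.*2.+3) ^ d < 2 ^ m.
Proof.
(* With [m = 2 ^ (i + i)], the left side is below [2 ^ (A + (i + i).+3 * d)], and that exponent is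
   at most [i.+1 * i.+1 <= m]. *)
pose i := A + 3 * d; exists (2 ^ (i + i)).
set m := 2 ^ (i + i).
have m1 : 0 < m by rewrite expn_gt0.
have le : m.*2.+3 <= 2 ^ (i + i).+3 by rewrite !expnS -/m; lia.
have step : A + (i + i).+3 * d <= m.
  have sq : i.+1 * i.+1 <= m by rewrite /m expnD leq_mul // ltn_expl.
  by apply: leq_trans sq; rewrite /i; nia.
apply: (@leq_trans (2 ^ (A + (i + i).+3 * d))); last by rewrite leq_exp2l.
rewrite expnD expnM; apply: (@leq_ltn_trans (A * (2 ^ (i + i).+3) ^ d)).
  by rewrite leq_mul2l leq_exp_base ?orbT.
have : 0 < 2 ^ (i + i).+3 by rewrite expn_gt0.
move: {le step m1 m} (2 ^ (i + i).+3) => b b0.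
have bd : 0 < b ^ d by rewrite expn_gt0 b0.
by rewrite (ltn_pmul2r bd); apply: ltn_expl.
Qed.

(** The sum of the absolute values of the coefficients bounds the polynomial, and the archimedean
    property replaces it by a natural number. *)
Lemma horner_le_pow (R : archiRealFieldType) (p : {poly R}) :
  exists A d : nat, forall n : nat, (p.[n%:R] <= (A * n.+1 ^ d)%:R)%R.
Proof.
pose c := (\sum_(i < size p) `|p`_i|)%R.
exists (Num.bound c), (size p) => n; rewrite horner_coef natrM.
have c0 : (0 <= c)%R by apply: sumr_ge0 => i _; apply: normr_ge0.
apply: (@Order.POrderTheory.le_trans _ _ (c * (n.+1 ^ size p)%:R)%R); last first.
  by rewrite ler_wpM2r ?ler0n // Order.POrderTheory.ltW // archi_boundP.
rewrite /c mulr_suml; apply: ler_sum => i _.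
apply: (@Order.POrderTheory.le_trans _ _ (`|p`_i| * n%:R ^+ i)%R).
  by rewrite ler_wpM2r ?exprn_ge0 ?ler0n // ler_norm.
rewrite ler_wpM2l ?normr_ge0 // -natrX ler_nat.
apply: (@leq_trans (n.+1 ^ i)); first exact: leq_exp_base.
by rewrite leq_pexp2l // ltnW.
Qed.

(** If all words [F bs] with [m] bits avoided [rho], they would give [2 ^ m] avoiders of length at
    most [m.*2.+2], too many for a polynomial once [m] is suitable. *)
Lemma growth_contains (R : archiRealFieldType) k (rho : 'S_k)
    (N : nat -> nat) (F : bitseq -> seq nat) :
  polynomial_growth R (r_count rho) ->
  (forall m, N m <= m.*2.+2) ->
  (forall bs, perm_eq (F bs) (iota 0 (N (size bs)))) ->
  (forall bs bs', size bs = size bs' -> F bs = F bs' -> bs = bs') ->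
  exists bs f, (forall i j, i < j < k -> f i < f j) /\
    subseq (map f (word rho)) (doubled (F bs)).
Proof.
move=> [p Hp] HN permF injF; have [A [d HA]] := horner_le_pow p.
have [m Hm] := exp_dominates A d.
suff /existsP[b /existsP[pi /andP[/eqP piE /contains_doubleP[f [fmon sub]]]]] :
    [exists b : m.-tuple bool, exists pi : 'S_(N m),
      (word pi == F b) && contains (rev_double pi) rho].
  by exists b, f; split=> //; rewrite -piE.
apply: contraT => /existsPn H.
have wF (b : m.-tuple bool) : exists pi : 'S_(N m), word pi == F b.
  have [|pi E] := @word_surj (N m) (F b); first by have := permF b; rewrite size_tuple.
  by exists pi; apply/eqP.
pose g b := xchoose (wF b).
have gE b : word (g b) = F b by apply/eqP/(xchooseP (wF b)).
have ginj : injective g.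
  move=> b b' E; apply: val_inj; apply: injF; first by rewrite !size_tuple.
  by rewrite -!gE E.
have le : 2 ^ m <= r_count rho (N m).
  rewrite r_countE; have <- : #|{: m.-tuple bool}| = 2 ^ m by rewrite card_tuple card_bool.
  rewrite -cardsT -(card_imset _ ginj); apply/subset_leq_card/subsetP => _ /imsetP[b _ ->].
  by rewrite inE; have /existsPn/(_ (g b)) := H b; rewrite gE eqxx.
have : ((2 ^ m)%:R <= (A * (N m).+1 ^ d)%:R :> R)%R.
  apply: Order.POrderTheory.le_trans (HA _).
  by apply: Order.POrderTheory.le_trans (Hp _); rewrite ler_nat.
rewrite ler_nat leqNgt => /negP[]; apply: leq_ltn_trans Hm.
by rewrite leq_mul2l leq_exp_base ?orbT // ltnS.
Qed.

(** * The classification *)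

Section StrictlyIncreasing.

Variables (f : nat -> nat) (k : nat).
Hypothesis fmon : forall i j, i < j < k -> f i < f j.

Lemma incr_lt i j : i < k -> j < k -> (f i < f j) = (i < j).
Proof.
move=> ik jk; case: (ltngtP i j) => [lt|lt|->]; last by rewrite ltnn.
  by rewrite fmon // lt.
by apply/negbTE; rewrite -leqNgt ltnW // fmon // lt.
Qed.

Lemma incr_all_gt x s : x < k -> all (gtn k) s ->
  all (ltn (f x)) (map f s) = all (ltn x) s.
Proof.
move=> xk /allP sk; rewrite all_map; apply: eq_in_all => y ys /=.
exact: incr_lt (sk y ys).
Qed.

Lemma incr_all_lt x s : x < k -> all (gtn k) s ->
  all (gtn (f x)) (map f s) = all (gtn x) s.
Proof.
move=> xk /allP sk; rewrite all_map; apply: eq_in_all => y ys /=.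
by apply: incr_lt => //; apply: sk.
Qed.

Lemma incr_sorted s : all (gtn k) s -> sorted ltn (map f s) -> sorted ltn s.
Proof.
move=> sk; rewrite sorted_map (eq_in_sorted (P := gtn k) (e' := ltn)) //.
by move=> x y xk yk /=; apply: incr_lt.
Qed.

Lemma incr_uniq s : all (gtn k) s -> uniq s -> uniq (map f s).
Proof.
move=> /allP sk Us; rewrite map_inj_in_uniq // => x y /sk xk /sk yk E.
have := incr_lt xk yk; have := incr_lt yk xk; rewrite E ltnn.
by case: ltngtP.
Qed.

End StrictlyIncreasing.

Lemma word_lt k (rho : 'S_k) : all (gtn k) (word rho).
Proof. by apply/allP => x; rewrite (perm_mem (perm_eq_word rho)) mem_iota. Qed.

Lemma extremal_end (R : archiRealFieldType) k (rho : 'S_k) : 0 < k ->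
  polynomial_growth R (r_count rho) ->
  exists x s, (word rho = x :: s \/ word rho = rcons s x) /\
    (x = 0 \/ x = k.-1).
Proof.
move=> k0 pg.
have [|||bs [f [fmon sub]]] :=
  growth_contains (N := succn) (F := suffix_word 0) pg.
- by move=> m; rewrite -addnn; lia.
- exact: perm_suffix_word.
- by move=> bs bs'; apply: suffix_word_inj.
have wk := word_lt rho; have wp := perm_eq_word rho.
have [||||x [t' [tE ext]]] := extremal_suffix_ends _ _ _ _ sub.
- by rewrite (perm_uniq (perm_suffix_word _ _)) iota_uniq.
- exact: suffix_word_extremal.
- by apply: incr_uniq wk _ => //; apply: word_uniq.
- by rewrite size_map size_word.
(* Extremality passes back through [f]; among all values below [k], the extremal ones are 0 and
   [k.-1]. *)
have conv u s : perm_eq (u :: s) (word rho) ->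
    all (ltn (f u)) (map f s) \/ all (gtn (f u)) (map f s) -> u = 0 \/ u = k.-1.
  move=> us; have /andP[uk sk] : all (gtn k) (u :: s) by rewrite (perm_all _ us).
  have mem v : v < k -> v \in u :: s.
    by move=> vk; rewrite (perm_mem us) (perm_mem wp) mem_iota.
  rewrite (incr_all_gt fmon) // (incr_all_lt fmon) // => -[/allP H|/allP H].
    by left; have := mem 0 k0; rewrite inE => /predU1P[->//|/H].
  have k1 : k.-1 < k by rewrite prednK.
  right; have := mem _ k1; rewrite inE => /predU1P[->//|/H /=].
  by move: uk => /=; lia.
case: tE => tE.
- case: (word rho) tE conv => // u s [xE tE] conv.
  by exists u, s; split; [left|apply: (conv u s); rewrite ?xE ?tE].
- case/lastP: (word rho) tE conv => [|s u]; first by case: (t').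
  rewrite map_rcons => /rcons_inj[tE xE] conv.
  exists u, s; split; [by right|apply: (conv u s); rewrite ?xE ?tE //].
  by rewrite perm_sym perm_rcons.
Qed.

Lemma word_eq_iota k (rho : 'S_k) : sorted ltn (word rho) -> rho = perm_one _.
Proof.
move=> rs; apply: word_inj; rewrite word_one.
apply: (irr_sorted_eq ltn_trans ltnn rs (iota_ltn_sorted _ _)).
exact: perm_mem (perm_eq_word rho).
Qed.

Lemma word_eq_swap k (rho : 'S_k) s x y : word rho = s ++ [:: y; x] ->
  sorted ltn (s ++ [:: x; y]) -> rho = swap_last k.
Proof.
move=> rE ss; have iE : s ++ [:: x; y] = iota 0 k.
  apply: (irr_sorted_eq ltn_trans ltnn ss (iota_ltn_sorted _ _)) => z.
  rewrite -(perm_mem (perm_eq_word rho)) rE !mem_cat !inE.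
  by rewrite [(z == x) || _]orbC.
have szs : (size s).+2 = k by rewrite -(size_iota 0 k) -iE size_cat addn2.
case: k rho rE iE szs => [|[|k]] rho rE iE //= [szs].
apply: word_inj; rewrite word_swap_last rE; move: iE.
rewrite -addn2 iotaD => /eqP; rewrite eqseq_cat ?size_iota //.
by case/andP=> /eqP-> /eqP[-> ->].
Qed.

Lemma growth_first_min (R : archiRealFieldType) k (rho : 'S_k) s0 :
  polynomial_growth R (r_count rho) -> word rho = 0 :: s0 ->
  rho = perm_one _ \/ rho = swap_last k.
Proof.
move=> pg rE; have wk := word_lt rho; have Uw := word_uniq rho.
have s0pos : all (ltn 0) s0.
  by apply/allP => -[|//]; move: Uw; rewrite rE /= => /andP[/negP].
have [k0 sk] : 0 < k /\ all (gtn k) s0 by move: wk; rewrite rE => /andP[].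
(* From the skew sums: [y] is the maximum of the pattern, and at most one letter follows it, which
   is then the second largest. A leading 0 rules out the forms with the large letters in front,
   except in very short words. *)
have : s0 = [::] \/ exists s y e, [/\ s0 = s ++ y :: e, all (gtn y) s, all (gtn y) e &
    e = [::] \/ exists2 x, e = [:: x] & all (gtn x) (0 :: s)].
  have [|||bs [f [fmon sub]]] :=
    growth_contains (N := double) (F := skew_word) pg.
  - by move=> m; rewrite -addnn; lia.
  - exact: perm_skew_word.
  - by move=> bs bs'; apply: skew_word_inj.
  have [|||||] := skew_layered_max _ _ _ _ sub.
  - by rewrite (perm_uniq (perm_skew_word _)) iota_uniq.
  - exact: skew_word_layered.
  - by apply: incr_uniq wk _.
  - by rewrite size_map size_word.
  - rewrite rE /= => -[x [t' [[[<- <-]|tE] xt]]].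
      left; case: (s0) s0pos sk xt => [//|u s] /= /andP[u0 _] /andP[uk _] /andP[].
      by rewrite (incr_lt fmon) // ltnNge ltnW.
    case/lastP: (s0) s0pos sk tE => [|s y]; first by left.
    rewrite !all_rcons map_rcons -rcons_cons => /andP[y0 _] /andP[yk sk'].
    move=> /rcons_inj[tE xE]; right; exists s, y, [::]; rewrite -cats1; split=> //.
      by move: xt; rewrite -tE -xE /= (incr_all_lt fmon) // => /andP[].
    by left.
  - rewrite rE => -[x [y [t' [[tE|tE] xt xy]]]].
      case: (s0) tE s0pos sk => [|u [|v s]] /=; first by left.
        by right; exists [::], u, [::]; split=> //; left.
      case=> xE _ tE /and3P[_ v0 _] /and3P[_ vk _]; move: xt.
      by rewrite -tE -xE /= (incr_lt fmon) // ltnNge ltnW.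
    have {}tE : map f (0 :: s0) = rcons (rcons t' y) x.
      by rewrite [LHS]tE -!cats1 -catA.
    case/lastP: (s0) s0pos sk tE => [|s u]; first by left.
    rewrite !all_rcons => /andP[u0 _] /andP[uk sk'].
    rewrite map_cons map_rcons -rcons_cons => /rcons_inj[].
    case/lastP: s sk' => [_|s v].
      move=> /(@rcons_inj _ [::] t' (f 0) y)[_ yE] xE; move: xy; rewrite -yE -xE.
      by rewrite (incr_lt fmon) // ltnNge ltnW.
    rewrite all_rcons => /andP[vk sk'].
    rewrite map_rcons -rcons_cons => /rcons_inj[tE yE] xE.
    have uv : u < v by rewrite -(incr_lt fmon) // xE yE.
    have su : all (gtn u) (0 :: s).
      by rewrite -(incr_all_lt fmon) /= ?k0 // xE; move: xt; rewrite -tE.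
    have vs : all (gtn v) s.
      by move: su => /andP[_]; apply: sub_all => z /= zu; apply: ltn_trans zu uv.
    right; exists s, v, [:: u]; split; rewrite /= ?uv //.
      by rewrite -!cats1 -catA.
    by right; exists u.
case=> [s0E|[s [y [e [s0E sy ey eE]]]]].
  by left; apply: word_eq_iota; rewrite rE s0E.
(* Reversed suffix words have extremal prefixes, which forces the letters before the maximum to
   ascend. *)
have s_sorted : sorted ltn (0 :: s).
  have [|||bs [f [fmon sub]]] :=
    growth_contains (N := succn) (F := rev \o suffix_word 0) pg.
  - by move=> m; rewrite -addnn; lia.
  - by move=> bs /=; rewrite perm_rev; apply: perm_suffix_word.
  - by move=> bs bs' sz /(inv_inj revK); apply: suffix_word_inj.
  have Uq : uniq (suffix_word 0 bs).
    by rewrite (perm_uniq (perm_suffix_word _ _)) iota_uniq.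
  have := incr_uniq fmon wk Uw; have := incr_all_gt fmon k0 sk.
  move: sub wk sk; rewrite rE s0E /= map_cat /= all_cat /=.
  move=> sub wk /and3P[sk yk ek]; rewrite -s0E s0pos => pos Uf.
  apply: (@incr_sorted f k fmon (0 :: s)); first by rewrite /= k0.
  apply: (extremal_prefix_sorted _ _ Uf pos _ _ sub).
  - by rewrite rev_uniq.
  - by apply: extremal_prefix_of_rev => //; apply: suffix_word_extremal.
  - by rewrite (incr_all_lt fmon).
  - by rewrite (incr_all_lt fmon).
have y0 : 0 < y by apply: (allP s0pos); rewrite s0E mem_cat mem_head orbT.
case: eE => [eE|[x eE sx]].
  left; apply: word_eq_iota; rewrite rE s0E eE -cat_cons cats1.
  by rewrite sorted_ltn_rcons s_sorted /= y0 sy.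
right; apply: (@word_eq_swap _ _ (0 :: s) x y); first by rewrite rE s0E eE.
rewrite -cat_rcons cats1 !sorted_ltn_rcons s_sorted sx !andbT all_rcons /= y0 sy.
by move: ey; rewrite eE /= andbT => ->.
Qed.

Lemma word_complement k (rho : 'S_k) :
  word (complement rho) = [seq k.-1 - v | v <- word rho].
Proof.
rewrite /word -map_comp; apply: eq_map => i /=; rewrite permE /=.
by have := ltn_ord (rho i); lia.
Qed.

Lemma polynomial_growth_eq (R : archiRealFieldType) (u v : nat -> nat) :
  u =1 v -> polynomial_growth R u -> polynomial_growth R v.
Proof. by move=> uv [p Hp]; exists p => n; rewrite -uv. Qed.

Lemma r_count_trivially_wilf k (rho tau : 'S_k) : trivially_wilf_equiv rho tau ->
  r_count tau =1 r_count rho.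
Proof.
rewrite /trivially_wilf_equiv !inE.
by case/or4P=> /eqP-> n; rewrite ?r_count_complement ?r_count_reversal.
Qed.

Theorem theorem19 (R : archiRealFieldType) (k : nat) (hk : (1 <= k)%N)
    (rho : 'S_k) :
  polynomial_growth R (r_count rho) <->
  trivially_wilf_equiv rho (perm_one _) \/
  trivially_wilf_equiv rho (swap_last k).
Proof.
split=> [pg|[] /r_count_trivially_wilf eq].
- have [x [s [xs xE]]] := extremal_end hk pg.
  (* Reversal brings the extremal letter to the front and complement turns it into 0 if necessary;
     neither changes the growth. *)
  suff [sigma [eqv [s0 sE]]] : exists sigma, trivially_wilf_equiv rho sigma /\
      exists s0, word sigma = 0 :: s0.
    have pg' : polynomial_growth R (r_count sigma).
      apply: polynomial_growth_eq pg => n; exact/esym/r_count_trivially_wilf.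
    by case: (growth_first_min pg' sE) => <-; [left|right].
  have [tau [tauE [s' tE]]] : exists tau, (tau = rho \/ tau = reversal rho) /\
      exists s', word tau = x :: s'.
    case: xs => rE; first by exists rho; split; [left|exists s].
    exists (reversal rho); split; first by right.
    by exists (rev s); rewrite word_reversal rE rev_rcons.
  case: xE => x0; rewrite x0 in tE.
    exists tau; split; last by exists s'.
    by case: tauE => ->; rewrite /trivially_wilf_equiv !inE eqxx ?orbT.
  exists (complement tau); split.
    by case: tauE => ->; rewrite /trivially_wilf_equiv !inE eqxx ?orbT.
  by rewrite word_complement tE /= subnn; exists [seq k.-1 - v | v <- s'].
- exact: polynomial_growth_eq eq (growth_one R k).
- exact: polynomial_growth_eq eq (growth_swap_last R k).
Qed.
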